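(* Let $G$ be a finite group. Then $G$ is $(2,7)$-centralizer if and only if either $G\cong D_{10}$, or $G\cong R$, or $Z(G)\neq 1$ and $G$ is $6$-centralizer. Moreover, $G$ is primitive $(2,7)$-centralizer if and only if $G\cong D_{10}$ or $G\cong R$.
   Context: All groups are finite. $Z(G)$ denotes the center of $G$. For a group $G$, $Cent(G)=\{C_G(x)\mid x\in G\}$ and $2\text{-}Cent(G) = \{ C_G(\{x,y\}) \mid x,y\in G,\ x\neq y\}$, where $C_G(\{x,y\}) = C_G(x)\cap C_G(y)$. A group $G$ is called $n$-centralizer if $|Cent(G)|=n$, $(2,n)$-centralizer if $|2\text{-}Cent(G)| = n$, and primitive $(2,n)$-centralizer if $|2\text{-}Cent(G)| = |2\text{-}Cent(G/Z(G))| = n$. $D_{2n}$ is the dihedral group of order $2n$. $R$ is the semidirect product of a cyclic group of order $5$ by a cyclic group of order $4$ acting faithfully, $R=\langle x,y\mid x^5=y^4=1,\ xy=yx^3\rangle$. *)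

(* Defs.v *)
From mathcomp Require Export all_boot all_fingroup all_solvable.

Set Implicit Arguments.
Unset Strict Implicit.
Unset Printing Implicit Defensive.

Local Open Scope group_scope.

Definition Cents (gT : finGroupType) (G : {group gT}) : {set {set gT}} :=
  [set 'C_G[x] | x in G].

(* C_G({x, y}) is the centralizer in G of the two-element set {x, y}. Since
   x and y must be distinct, G itself is a member iff its center is nontrivial,
   and the set is empty when G is trivial. *)
Definition two_Cents (gT : finGroupType) (G : {group gT}) : {set {set gT}} :=
  [set 'C_G([set x; y]) | x in G, y in G & x != y].

Definition n_centralizer (n : nat) (gT : finGroupType) (G : {group gT}) : Prop :=
  #|Cents G| = n.

Definition two_n_centralizer (n : nat) (gT : finGroupType) (G : {group gT}) :
    Prop :=
  #|two_Cents G| = n.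

Definition primitive_two_n_centralizer (n : nat) (gT : finGroupType)
    (G : {group gT}) : Prop :=
  #|two_Cents G| = #|two_Cents (G / 'Z(G))%G| /\
  #|two_Cents (G / 'Z(G))%G| = n.

(* G is isomorphic to R = C_5 : C_4 with faithful action, given by its
   presentation. That group is finite (of order 20), so the library's [Grp],
   which denotes the largest finite quotient of the presented group, is R. *)
Definition isog_R (gT : finGroupType) (G : {group gT}) : Prop :=
  G \isog Grp (x : y : x ^+ 5, y ^+ 4, x * y = y * x ^+ 3).

(* Main.v *)
Require Import Defs.
From mathcomp Require Import ssralg finalg zmodp zify.

(** If a nonabelian centralizer C(x) contained two noncommuting elements y, z,
    then G, C(x), C(y), C(z), C(yz) would be distinct centralizers containing x;
    when |Cent(G)| <= 7 at most two classes of equal centralizers are left for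
    the elements outside C(x), and comparing the classes of w, wc, wcx for w
    outside and c inside C(x) forces C(x) to be abelian. Hence all noncentral
    centralizers are abelian (G is a CA-group), they meet pairwise in Z(G), and
    2-Cent(G) is obtained from Cent(G) by adding Z(G) and, if Z(G) = 1,
    removing G. So a (2,7)-centralizer group has |Cent(G)| = 6 if Z(G) != 1
    and |Cent(G)| = 7 if Z(G) = 1.

    In the latter case G is partitioned by six self-centralizing abelian
    subgroups. A coset of one of them meets each of the other five at most
    once, so they have order at most 5; counting elements leaves only the
    orders 10 and 20, where one subgroup is normal of order 5, whence D_10
    and R.

    For the primitive case, if Z(G) != 1 and |Cent(G)| = 6, the same coset
    argument shows that G/Z(G) has no element of order 5, and that
    |Cent(G/Z(G))| < 6 as soon as G/Z(G) is a nonabelian CA-group with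
    nontrivial center. *)

Set Implicit Arguments.
Unset Strict Implicit.
Unset Printing Implicit Defensive.

Local Open Scope group_scope.

(** * Centralizers, CA-groups, and the comparison of Cent(G) with 2-Cent(G) *)

Section CAGroups.

Variable gT : finGroupType.
Implicit Types (G : {group gT}) (x y z w : gT).

Lemma cent_pair G x y : 'C_G([set x; y]) = 'C_G[x] :&: 'C_G[y].
Proof. by rewrite centU !cent_set1 -setIIr. Qed.

Lemma subcent1_refl G x : x \in G -> x \in 'C_G[x].
Proof. by move=> Gx; apply/subcent1P. Qed.

Lemma subcent1_sym G x y : y \in 'C_G[x] -> x \in G -> x \in 'C_G[y].
Proof. by case/subcent1P=> Gy cxy Gx; apply/subcent1P. Qed.

Lemma subcent1_eqG G x : x \in G -> ('C_G[x] == G :> {set gT}) = (x \in 'Z(G)).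
Proof.
by move=> Gx; rewrite in_setI Gx -sub_cent1; apply/eqP/idP=> /setIidPl.
Qed.

Lemma mem_Cents G x : x \in G -> 'C_G[x] \in Cents G.
Proof. exact: imset_f. Qed.

Lemma CentsG G : gval G \in Cents G.
Proof.
have /eqP <-: 'C_G[1] == G by rewrite subcent1_eqG ?group1.
exact: mem_Cents.
Qed.

Lemma proper_CentsP G (A : {set gT}) :
  reflect (exists x, [/\ x \in G, x \notin 'Z(G) & A = 'C_G[x]])
          (A \in Cents G :\ gval G).
Proof.
apply: (iffP idP) => [/setD1P[neAG /imsetP[x Gx defA]] | [x [Gx ncx ->]]].
  by exists x; split=> //; rewrite -subcent1_eqG // -defA.
by rewrite !inE subcent1_eqG // ncx mem_Cents.
Qed.

Definition CA_group (G : {set gT}) :=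
  [forall x in G :\: 'Z(G), abelian 'C_G[x]].

Lemma CA_cent1_abelian G x :
  CA_group G -> x \in G -> x \notin 'Z(G) -> abelian 'C_G[x].
Proof. by move/forall_inP=> caG Gx ncx; apply: caG; rewrite inE ncx. Qed.

Lemma CA_cent1_eq G x y : CA_group G -> x \in G -> x \notin 'Z(G) ->
  y \notin 'Z(G) -> y \in 'C_G[x] -> 'C_G[y] = 'C_G[x].
Proof.
move=> caG Gx ncx ncy Cxy; have [Gy _] := subcent1P _ _ _ Cxy.
have aux u v : u \in G -> u \notin 'Z(G) -> v \in 'C_G[u] ->
  'C_G[u] \subset 'C_G[v].
- move=> Gu ncu Cuv; rewrite subsetI subsetIl sub_cent1.
  exact: (subsetP (CA_cent1_abelian caG Gu ncu)).
apply/eqP; rewrite eqEsubset !aux //; exact: subcent1_sym.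
Qed.

(** Both [x * a] and [x * b] lie in their common centralizer, hence so does the quotient, in which
    [x] cancels. *)
Lemma subcent1_mulr_mem G x a b :
    'C_G[x * a] = 'C_G[x * b] -> x \in G -> a \in G -> b \in G ->
  a^-1 * b \in 'C_G[x * a].
Proof.
move=> eqC Gx Ga Gb; have ->: a^-1 * b = (x * a)^-1 * (x * b).
  by rewrite invMg !mulgA mulgKV.
apply: groupM; first by rewrite groupV subcent1_refl ?groupM.
by rewrite /= eqC subcent1_refl ?groupM.
Qed.


Lemma card_Cents_le7_CA G : #|Cents G| <= 7 -> CA_group G.
Proof.
move=> le7; apply/forall_inP=> x /setDP[Gx ncx]; apply/centsP=> y Xy z Xz.
apply/eqP/idPn=> /eqP not_cyz.
have [[Gy cxy] [Gz cxz]] := (subcent1P _ _ _ Xy, subcent1P _ _ _ Xz).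
(* [T] and [S] are disjoint, since [w] outside ['C_G[x]] means [x] outside ['C_G[w]]. [T] has at
   least five members, so at most two are left for [S]. *)
pose T := [set C in Cents G | x \in C].
pose S : {set {set gT}} := [set 'C_G[w] | w in G :\: 'C_G[x]].
have card_T : 4 < #|T|.
  have not_yz : z \in 'C_G[y] = false by apply/subcent1P=> -[_].
  have not_zy : y \in 'C_G[z] = false.
    by apply: contraFF not_yz => /subcent1_sym; apply.
  have not_yzy : y \in 'C_G[y * z] = false.
    apply: contraFF not_yz => /subcent1_sym-/(_ (groupM Gy Gz)).
    by rewrite groupMl // subcent1_refl.
  have not_yzz : z \in 'C_G[y * z] = false.
    apply: contraFF not_zy => /subcent1_sym-/(_ (groupM Gy Gz)).
    by rewrite groupMr // subcent1_refl.
  have neq (A B : {set gT}) u : u \in A -> (u \in B) = false -> A != B.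
    by move=> Au nBu; apply: contraFneq nBu => <-.
  apply/card_geqP; exists [:: gval G; 'C_G[x]; 'C_G[y]; 'C_G[z]; 'C_G[y * z]].
  split=> //.
    rewrite /= !inE !negb_or eq_sym subcent1_eqG // ncx /=.
    rewrite (neq G _ _ Gz not_yz) (neq G _ _ Gy not_zy) (neq G _ _ Gy not_yzy).
    rewrite (neq _ _ _ Xz not_yz) (neq _ _ _ Xy not_zy) (neq _ _ _ Xy not_yzy).
    rewrite (neq _ _ _ (subcent1_refl Gy) not_zy).
    rewrite (neq _ _ _ (subcent1_refl Gy) not_yzy).
    by rewrite (neq _ _ _ (subcent1_refl Gz) not_yzz).
  have memT u : u \in 'C_G[x] -> 'C_G[u] \in T.
    move=> Xu; rewrite inE (subcent1_sym Xu Gx) andbT mem_Cents //.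
    by case/subcent1P: Xu.
  apply/allP; rewrite /= !memT ?groupM ?subcent1_refl // andbT.
  by rewrite inE CentsG Gx.
have card_S : #|S| <= 2.
  have TS0 : [disjoint T & S].
    rewrite disjoint_sym disjoint_subset;
      apply/subsetP=> _ /imsetP[w /setDP[Gw nXw] ->].
    rewrite inE [X in ~~ X]inE mem_Cents //=.
    by apply: contra nXw => Cwx; apply: subcent1_sym Cwx Gw.
  have : #|T :|: S| <= #|Cents G|.
    apply/subset_leq_card/subUsetP; split; apply/subsetP=> A.
      by rewrite inE => /andP[].
    by case/imsetP=> w /setDP[Gw _] ->; apply: mem_Cents.
  rewrite cardsU (disjoint_setI0 TS0) cards0 subn0 => leTS.
  rewrite -(leq_add2l 5); apply: leq_trans le7; apply: leq_trans leTS.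
  by rewrite leq_add2r.
have [w Gw nXw] : exists2 w, w \in G & w \notin 'C_G[x].
  apply/subsetPn; apply: contra ncx => sGX.
  by rewrite -subcent1_eqG // eqEsubset subsetIl.
have GX u : u \in 'C_G[x] -> u \in G by case/subcent1P.
have S_mem u : u \in 'C_G[x] -> 'C_G[w * u] \in S.
  move=> Xu; apply: imset_f; rewrite in_setD (groupMr _ Xu) nXw.
  by rewrite groupM // GX.
have Xx := subcent1_refl Gx.
(* Two of the centralizers of [w * u], [w * u * x] and [w] coincide. The first two differ, as
   otherwise [x] would commute with [w * u], which lies outside ['C_G[x]]. So [u] or [u * x] can be
   multiplied onto [w] without changing its centralizer. *)
have fix_class u : u \in 'C_G[x] ->
  exists2 u', u' = u \/ u' = u * x & 'C_G[w * u'] = 'C_G[w].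
- move=> Xu; case: (eqVneq 'C_G[w * u] 'C_G[w]) => [|ne_u];
    first by exists u => //; left.
  exists (u * x); first by right.
  apply/eqP; apply: contraLR card_S => ne_ux; rewrite -ltnNge; apply/card_geqP.
  exists [:: 'C_G[w * u]; 'C_G[w * (u * x)]; 'C_G[w]]; split=> //.
    rewrite /= !inE negb_or ne_u ne_ux /= !andbT.
    apply/eqP=> eqC.
    have := subcent1_mulr_mem eqC Gw (GX u Xu) (groupM (GX u Xu) Gx).
    rewrite mulKg => /subcent1_sym/(_ (groupM Gw (GX u Xu))).
    by rewrite (groupMr _ Xu) (negPf nXw).
  have S_w : 'C_G[w] \in S by have := S_mem 1 (group1 _); rewrite mulg1.
  by apply/allP; rewrite /= S_w !S_mem // groupM.
have [[y' def_y' eqCy] [z' def_z' eqCz]] := (fix_class y Xy, fix_class z Xz).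
have X' u u' : u \in 'C_G[x] -> u' = u \/ u' = u * x -> u' \in 'C_G[x].
  by move=> Xu [] ->; rewrite ?groupM.
have Cw u : u \in 'C_G[x] -> 'C_G[w * u] = 'C_G[w] -> u \in 'C_G[w].
  move=> Xu eqC; have := @subcent1_mulr_mem G w 1 u.
  by rewrite mulg1 invg1 mul1g; apply; rewrite ?group1 // GX.
have Xy' := X' _ _ Xy def_y'; have Xz' := X' _ _ Xz def_z'.
have {}Cwz := Cw _ Xz' eqCz.
(* [z'] commutes with [w], hence with [w * y'], which has the same centralizer, and so with [y'].
   The possible factors [x] then drop out because [x] commutes with [y] and [z]. *)
have cyz' : y' \in 'C[z'].
  have : z' \in 'C_G[w * y'] by rewrite eqCy.
  move/subcent1_sym/(_ (groupM Gw (GX _ Xy'))).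
  by rewrite (groupMl _ (subcent1_sym Cwz Gw)) => /setIP[].
have cxz' : x \in 'C[z'] by rewrite cent1C; case/setIP: Xz'.
have cyz : y \in 'C[z'] by move: cyz'; case: def_y' => ->; rewrite ?groupMr.
have cxy' : x \in 'C[y] by apply/cent1P.
apply/not_cyz/esym/cent1P; rewrite cent1C in cyz.
by move: cyz; case: def_z' => ->; rewrite ?groupMr.
Qed.


(** For noncentral [x] and [y], a noncentral [z] in the intersection forces both centralizers to
    equal that of [z]. A central [x] or [y] contributes all of G. *)
Lemma CA_abelian_cent_pair G x y : CA_group G -> x \in G -> y \in G ->
  [\/ 'C_G[x] :&: 'C_G[y] = 'C_G[x], 'C_G[x] :&: 'C_G[y] = 'C_G[y]
    | 'C_G[x] :&: 'C_G[y] = 'Z(G)].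
Proof.
move=> caG Gx Gy.
have [Zx|ncx] := boolP (x \in 'Z(G)).
  constructor 2; apply/setIidPr; rewrite -subcent1_eqG // in Zx.
  by rewrite (eqP Zx) subsetIl.
have [Zy|ncy] := boolP (y \in 'Z(G)).
  constructor 1; apply/setIidPl; rewrite -subcent1_eqG // in Zy.
  by rewrite (eqP Zy) subsetIl.
have [/subsetP sZ | /subsetPn[z /setIP[Cxz Cyz] ncz]] :=
    boolP ('C_G[x] :&: 'C_G[y] \subset 'Z(G)); last first.
  constructor 1; rewrite -(CA_cent1_eq caG Gx ncx ncz Cxz).
  by rewrite -(CA_cent1_eq caG Gy ncy ncz Cyz) setIid.
constructor 3; apply/eqP; rewrite eqEsubset; apply/andP; split;
  first exact/subsetP.
have sZC u : u \in G -> 'Z(G) \subset 'C_G[u].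
  by move=> Gu; rewrite setIS // -cent_set1 centS // sub1set.
by rewrite subsetI !sZC.
Qed.

(** If Z(G) were C_G(x), then x would be central and its centralizer all of G. Hence Z(G) counts as
    a new member of 2-Cent(G). *)
Lemma center_notin_Cents G : ~~ abelian G -> 'Z(G) \notin Cents G.
Proof.
apply: contra => /imsetP[x Gx defZ].
have Zx : x \in 'Z(G) by rewrite defZ subcent1_refl.
by move: Zx; rewrite -subcent1_eqG // -defZ => /eqP/center_idP.
Qed.

Lemma two_CentsP G (A : {set gT}) :
  reflect (exists x y, [/\ x \in G, y \in G, x != y & A = 'C_G[x] :&: 'C_G[y]])
          (A \in two_Cents G).
Proof.
apply: (iffP imset2P) => [[x y Gx + ->]|[x [y [Gx Gy nexy ->]]]].
  by rewrite inE => /andP[Gy nexy]; exists x, y; rewrite cent_pair.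
by exists x y; rewrite ?inE ?Gy ?cent_pair.
Qed.

Lemma proper_Cents_sub_two_Cents G : Cents G :\ gval G \subset two_Cents G.
Proof.
apply/subsetP=> _ /proper_CentsP[x [Gx ncx ->]]; apply/two_CentsP.
exists x, 1; split=> //; first by apply: contraNneq ncx => ->.
by rewrite cent11T setIT; apply/esym/setIidPl/subsetIl.
Qed.

Lemma mem_two_Cents_self G : (gval G \in two_Cents G) = ('Z(G) != 1).
Proof.
apply/two_CentsP/idP => [[x [y [Gx Gy nexy eqG]]] | /trivgPn[z Zz nz1]].
  have Zin u : u \in G -> G \subset 'C_G[u] -> u \in 'Z(G).
    by move=> Gu sG; rewrite -subcent1_eqG // eqEsubset subsetIl.
  have Zx : x \in 'Z(G) by apply: Zin => //; rewrite {1}eqG subsetIl.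
  have Zy : y \in 'Z(G) by apply: Zin => //; rewrite {1}eqG subsetIr.
  by apply: contraNneq nexy => Z1; move: Zx Zy;
    rewrite Z1 !inE => /eqP-> /eqP->.
have Gz := subsetP (center_sub G) z Zz.
exists z, 1; split=> //; apply/esym; rewrite -subcent1_eqG // in Zz.
by rewrite (eqP Zz) cent11T setIT setIid.
Qed.

Lemma CA_two_Cents G : CA_group G -> ~~ abelian G ->
  two_Cents G = 'Z(G) |: (if 'Z(G) == 1 then Cents G :\ gval G else Cents G).
Proof.
move=> caG nabG; apply/eqP; rewrite eqEsubset; apply/andP; split.
  apply/subsetP=> A A2; case: (A =P gval G) => [defA|/eqP neAG].
    move: A2; rewrite defA mem_two_Cents_self => /negPf->.
    by rewrite inE CentsG orbT.
  have /two_CentsP[x [y [Gx Gy _ defA]]] := A2.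
  have: (A \in Cents G) || (A == 'Z(G)).
    rewrite defA; case: (CA_abelian_cent_pair caG Gx Gy) => ->.
    - by rewrite mem_Cents.
    - by rewrite mem_Cents.
    by rewrite eqxx orbT.
  by rewrite !inE; case: ifP => _; rewrite ?inE ?neAG orbC.
rewrite subUset sub1set; apply/andP; split; last first.
  case: ifP => [_|/negbT ntZ]; first exact: proper_Cents_sub_two_Cents.
  by rewrite -(setD1K (CentsG G)) subUset sub1set mem_two_Cents_self ntZ
             proper_Cents_sub_two_Cents.
(* Z(G) is obtained from any two noncommuting elements: if one centralizer contained the other, [x]
   and [y] would commute. *)
have [x Gx ncx] : exists2 x, x \in G & x \notin 'Z(G).
  apply/subsetPn; apply: contra nabG => sGZ.
  by apply/center_idP/eqP; rewrite eqEsubset center_sub.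
have [y Gy nCxy] : exists2 y, y \in G & y \notin 'C_G[x].
  apply/subsetPn; apply: contra ncx => sGC.
  by rewrite -subcent1_eqG // eqEsubset subsetIl.
apply/two_CentsP; exists x, y; split=> //.
  by apply: contraNneq nCxy => <-; apply: subcent1_refl.
have [/setIidPl sxy | /setIidPr syx | -> //] := CA_abelian_cent_pair caG Gx Gy.
  by rewrite (subcent1_sym (subsetP sxy x (subcent1_refl Gx))) in nCxy.
by rewrite (subsetP syx y (subcent1_refl Gy)) in nCxy.
Qed.

Lemma CA_card_two_Cents G : CA_group G -> ~~ abelian G ->
  #|two_Cents G| = (#|Cents G| + ('Z(G) != 1%g))%N.
Proof.
move=> caG nabG; have ncZ := center_notin_Cents nabG.
rewrite CA_two_Cents // cardsU1; case: eqP => _ /=.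
  by rewrite !inE (negPf ncZ) andbF (cardsD1 (gval G) (Cents G)) CentsG addn0.
by rewrite ncZ addn1 add1n.
Qed.

(* A centralizer of least order would lie inside every other one. *)
Lemma two_Cents_not_sub_Cents G : ~~ abelian G -> ~~ (two_Cents G \subset
  Cents G).
Proof.
apply: contra => /subsetP s2C.
case: (@arg_minnP _ (gval G) [in Cents G] (fun A => #|A|) (CentsG G)).
move=> A /imsetP[x Gx ->] minC.
suff sCC y : y \in G -> 'C_G[x] \subset 'C_G[y].
  have Zx : x \in 'Z(G).
    rewrite inE Gx; apply/centP => y Gy.
    by case/subcent1P: (subsetP (sCC y Gy) x (subcent1_refl Gx)).
  move: Zx; rewrite -subcent1_eqG // => /eqP eqG.
  apply/centsP=> u Gu v Gv; have := subsetP (sCC v Gv) u;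
    rewrite eqG => /(_ Gu).
  by case/subcent1P.
move=> Gy; apply/setIidPl/eqP; rewrite eqEcard subsetIl minC //.
have [-> | nexy] := eqVneq x y; first by rewrite setIid mem_Cents.
by apply/s2C/two_CentsP; exists x, y.
Qed.

Lemma abelian_card_Cents G : abelian G -> #|Cents G| = 1%N.
Proof.
move=> abG; apply/eqP/cards1P; exists (gval G); apply/setP=> A; rewrite inE.
apply/imsetP/eqP => [[x Gx ->]|->].
  by apply/eqP; rewrite subcent1_eqG // (center_idP abG).
by have /imsetP := CentsG G.
Qed.

Lemma abelian_card_two_Cents G : abelian G -> #|two_Cents G| <= 1.
Proof.
move=> abG; rewrite -(cards1 (gval G)); apply/subset_leq_card/subsetP=> A.
case/two_CentsP=> x [y [Gx Gy _ ->]]; rewrite inE.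
have eqG u : u \in G -> 'C_G[u] = G.
  by move=> Gu; apply/eqP; rewrite subcent1_eqG // (center_idP abG).
by rewrite !eqG // setIid.
Qed.

(** Proper centralizers always belong to 2-Cent(G). If |Cent(G)| exceeded 7, they would exhaust
    2-Cent(G), contrary to [two_Cents_not_sub_Cents]; so [card_Cents_le7_CA] applies. *)
Lemma two_7_centralizer_CA G : #|two_Cents G| = 7 ->
  [/\ CA_group G, ~~ abelian G & #|Cents G| = if 'Z(G) == 1 then 7 else 6].
Proof.
move=> o2; have nabG : ~~ abelian G.
  by apply/negP=> /abelian_card_two_Cents; rewrite o2.
suff caG : CA_group G.
  split=> //; move: o2; rewrite CA_card_two_Cents //; case: eqP => _ /=.
    by rewrite addn0.
  by rewrite addn1 => -[].
apply: card_Cents_le7_CA; rewrite leqNgt; apply/negP=> gt7.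
have oC : #|Cents G| = #|Cents G :\ gval G|.+1 by rewrite (cardsD1 (gval G))
  CentsG.
have /negP[] := two_Cents_not_sub_Cents nabG.
have/eqP <- : Cents G :\ gval G == two_Cents G; last exact: subD1set.
by rewrite eqEcard proper_Cents_sub_two_Cents o2 -ltnS -oC.
Qed.

(** Noncentral elements are sorted by their centralizer; by [CA_cent1_eq] the class belonging to
    C_G(x) is C_G(x) without Z(G). *)
Lemma CA_sum_proper_Cents G : CA_group G ->
  (\sum_(A in Cents G :\ gval G) #|A :\: 'Z(G)| = #|G :\: 'Z(G)|)%N.
Proof.
move=> caG; rewrite -[RHS]sum1_card.
rewrite (partition_big (fun x => 'C_G[x]) [in Cents G :\ gval G]) /=;
  last first.
  by move=> x /setDP[Gx ncx]; apply/proper_CentsP; exists x.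
apply: eq_bigr => _ /proper_CentsP[x [Gx ncx ->]].
rewrite -sum1_card; apply: eq_bigl => y; rewrite !in_setD.
have [//|ncy] /= := boolP (y \in 'Z(G)).
apply/idP/andP => [Cxy | [Gy /eqP<-]]; last exact: subcent1_refl.
by rewrite (CA_cent1_eq caG Gx ncx ncy Cxy); case/subcent1P: Cxy.
Qed.

End CAGroups.

(** * Cosets of a centralizer in a CA-group *)

Section SevenCentralizers.

Variable gT : finGroupType.
Implicit Types (G : {group gT}) (x y z w h : gT).

Lemma conjg_iter_exp x y i k : x ^ y = x ^+ i -> x ^ (y ^+ k) = x ^+ (i ^ k).
Proof.
move=> xy; elim: k => [|k IHk]; first by rewrite conjg1.
by rewrite expgSr conjgM IHk conjXg xy -expgM expnS mulnC.
Qed.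

(** If [a^-1 * b] were noncentral, its centralizer would be that of [x]; but it commutes with
    [h * a], which would put [h] in ['C_G[x]]. *)
Lemma CA_coset_class G x h a b : CA_group G -> x \in G -> x \notin 'Z(G) ->
    h \in G -> h \notin 'C_G[x] -> a \in 'C_G[x] -> b \in 'C_G[x] ->
  'C_G[h * a] = 'C_G[h * b] -> a^-1 * b \in 'Z(G).
Proof.
move=> caG Gx ncx Gh nCh Ca Cb eqC.
have [[Ga _] [Gb _]] := (subcent1P _ _ _ Ca, subcent1P _ _ _ Cb).
have Cab : a^-1 * b \in 'C_G[x] by rewrite groupM ?groupV.
apply: contraR nCh => ncab.
have := subcent1_sym (subcent1_mulr_mem eqC Gh Ga Gb) (groupM Gh Ga).
by rewrite (CA_cent1_eq caG Gx ncx ncab Cab) (groupMr _ Ca).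
Qed.

Lemma coset_class_mem G x h a : x \in G -> h \in G -> h \notin 'C_G[x] ->
  a \in 'C_G[x] -> 'C_G[h * a] \in Cents G :\ gval G :\ 'C_G[x].
Proof.
move=> Gx Gh nCh Ca; have [Ga _] := subcent1P _ _ _ Ca.
have nCha : h * a \notin 'C_G[x] by rewrite groupMr.
have Gha := groupM Gh Ga.
apply/setD1P; split.
  by apply: contraNneq nCha => <-; apply: subcent1_refl.
apply/proper_CentsP; exists (h * a); split=> //; apply: contra nCha.
move=> /setIP[_ /centP cha]; rewrite in_setI Gha; exact/cent1P/cha.
Qed.

(** * Trivial center and seven centralizers: the order is 10 or 20 *)

Section TrivialCenter.

Variable G : {group gT}.
Hypotheses (caG : CA_group G) (Z1 : 'Z(G) = 1) (oC : #|Cents G| = 7).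
Let P := Cents G :\ gval G.

Lemma card_proper_Cents7 : #|P| = 6.
Proof. by apply/eqP; rewrite -eqSS -oC [in X in _ == X](cardsD1 (gval G))
  CentsG. Qed.

Lemma proper_Cents_center1P (A : {set gT}) :
  reflect (exists x, [/\ x \in G, x != 1 & A = 'C_G[x]]) (A \in P).
Proof.
apply: (iffP (proper_CentsP G A)) => -[x [Gx ncx ->]]; exists x; split=> //.
  by apply: contra ncx => /eqP->.
by rewrite Z1 inE.
Qed.

Lemma proper_Cents_TI A B : A \in P -> B \in P -> A != B -> A :&: B = 1.
Proof.
case/proper_CentsP=> x [Gx ncx ->] /proper_CentsP[y [Gy ncy ->]] neC.
apply/trivgP/subsetP=> z /setIP[Cxz Cyz]; apply: contraNT neC => nz1.
have ncz : z \notin 'Z(G) by rewrite Z1.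
by rewrite -(CA_cent1_eq caG Gx ncx ncz Cxz) (CA_cent1_eq caG Gy ncy ncz Cyz).
Qed.

Lemma card_sum_proper_Cents : (\sum_(A in P) #|A|.-1 = #|G|.-1)%N.
Proof.
have card_D1 (H : {group gT}) : #|H :\: 'Z(G)| = #|H|.-1.
  by rewrite Z1 (cardsD1 1 H) group1.
rewrite -card_D1 -CA_sum_proper_Cents //.
by apply: eq_bigr => _ /proper_CentsP[x [_ _ ->]]; rewrite card_D1.
Qed.

Lemma card_proper_Cents_gt1 A : A \in P -> 1 < #|A|.
Proof.
case/proper_Cents_center1P=> x [Gx nx1 ->]; rewrite cardG_gt1.
by apply/trivgPn; exists x; rewrite ?subcent1_refl.
Qed.

Lemma proper_Cents_class_inj x h : x \in G -> x != 1 -> h \in G ->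
  h \notin 'C_G[x] -> {in 'C_G[x] &, injective (fun a => 'C_G[h * a])}.
Proof.
move=> Gx nx1 Gh nCh a b Ca Cb eqC.
have ncx : x \notin 'Z(G) by rewrite Z1 inE.
have := CA_coset_class caG Gx ncx Gh nCh Ca Cb eqC.
by rewrite Z1 => /set1P/eqP; rewrite -eq_mulVg1 => /eqP.
Qed.

Lemma proper_Cents_class_sub x h : x \in G -> h \in G -> h \notin 'C_G[x] ->
  [set 'C_G[h * a] | a in 'C_G[x]] \subset P :\ 'C_G[x].
Proof.
move=> Gx Gh nCh; apply/subsetP=> _ /imsetP[a Ca ->].
exact: coset_class_mem.
Qed.

Lemma card_proper_CentsD1 A : A \in P -> #|P :\ A| = 5.
Proof. by move=> PA; have := cardsD1 A P;
  rewrite PA card_proper_Cents7 => -[]. Qed.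

(** For [h] outside [A], sending [a] to the centralizer of [h * a] injects [A] into the five other
    members of [P]. *)
Lemma card_proper_Cents_le5 A : A \in P -> #|A| <= 5.
Proof.
move=> PA; case/proper_Cents_center1P: (PA) => x [Gx nx1 defA].
have ncx : x \notin 'Z(G) by rewrite Z1 inE.
have [h Gh nCh] : exists2 h, h \in G & h \notin 'C_G[x].
  apply/subsetPn; apply: contra ncx => sGC.
  by rewrite -subcent1_eqG // eqEsubset subsetIl.
rewrite -(card_proper_CentsD1 PA) defA.
rewrite -(card_in_imset (proper_Cents_class_inj Gx nx1 Gh nCh)).
exact/subset_leq_card/proper_Cents_class_sub.
Qed.

(** Now the injection into the five other members is onto, so every coset [h * A] outside [A] meets
    [B]. Thus G = BA, with trivial intersection. *)
Lemma card5_proper_Cents A B : A \in P -> B \in P -> B != A -> #|A| = 5 ->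
  #|G| = (#|B| * 5)%N.
Proof.
move=> PA PB neBA o5; have TI := proper_Cents_TI PB PA neBA.
case/proper_Cents_center1P: (PA) => x [Gx nx1 defA].
case/proper_Cents_center1P: (PB) => y [Gy ny1 defB].
have sGBA : G \subset B * A.
  apply/subsetP=> h Gh; have [Ah|nAh] := boolP (h \in A).
    by rewrite -[h]mul1g mem_mulg // defB group1.
  rewrite defA in nAh.
  have : B \in [set 'C_G[h * a] | a in 'C_G[x]].
    have /eqP -> : [set 'C_G[h * a] | a in 'C_G[x]] == P :\ 'C_G[x].
      rewrite eqEcard proper_Cents_class_sub //=.
      rewrite (card_in_imset (proper_Cents_class_inj Gx nx1 Gh nAh)).
      by rewrite -defA o5 card_proper_CentsD1.
    by rewrite -defA in_setD1 neBA.
  case/imsetP=> a Ca defB'; have [Ga _] := subcent1P _ _ _ Ca.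
  rewrite -(mulgK a h) mem_mulg //; last by rewrite defA groupV.
  by rewrite defB' subcent1_refl ?groupM.
have sBAG : B * A \subset G by rewrite defA defB mul_subG ?subsetIl.
have -> : gval G = B * A by apply/eqP; rewrite eqEsubset sGBA.
have := @TI_cardMg _ 'C_G[y] 'C_G[x]; rewrite /= -defA -defB => -> //.
by rewrite o5.
Qed.

Lemma proper_Cents_conj A g : A \in P -> g \in G -> A :^ g \in P.
Proof.
case/proper_Cents_center1P=> x [Gx nx1 ->] Gg; apply/proper_Cents_center1P.
exists (x ^ g); rewrite groupJ // conjg_eq1; split=> //.
by rewrite conjIg conjGid // cent1J.
Qed.

Lemma proper_Cents_cent1 A x : A \in P -> x \in A -> x != 1 -> A = 'C_G[x].
Proof.
case/proper_CentsP=> y [Gy ncy ->] Cyx nx1; apply/esym.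
by apply: CA_cent1_eq Cyx; rewrite // Z1 inE.
Qed.

Lemma proper_Cents_sub A : A \in P -> A \subset G.
Proof. by case/proper_CentsP=> x [_ _ ->]; apply: subsetIl. Qed.

Lemma card_proper_Cents_dvd A : A \in P -> #|A| %| #|G|.
Proof. by case/proper_CentsP=> x [_ _ ->]; rewrite cardSg ?subsetIl. Qed.

Lemma invariant_proper_Cents_class A x :
    A \in P -> {in G, forall g, A :^ g = A} -> x \in A -> x != 1 ->
  x ^: G \subset A^# /\ #|G| = (#|A| * #|x ^: G|)%N.
Proof.
move=> PA nAG Ax nx1; split.
  apply/subsetP=> _ /imsetP[g Gg ->]; rewrite in_setD1 conjg_eq1 nx1 /=.
  by rewrite -(nAG g Gg) memJ_conjg.
by rewrite (proper_Cents_cent1 PA Ax nx1) -index_cent1 Lagrange ?subsetIl.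
Qed.

(** These members are Sylow 3-subgroups, so they are the conjugates of [A]. Their number is the
    index of a normalizer containing [A], whose order is divisible by 3. *)
Lemma card_proper_Cents3_dvd4 A : A \in P -> #|A| = 3 -> #|G| = 12 ->
  #|[set B in P | #|B| == 3]| %| 4.
Proof.
move=> PA o3 oG.
have -> : [set B in P | #|B| == 3] = A :^: G.
  apply/setP=> B; rewrite inE; apply/andP/imsetP => [[PB /eqP oB] | [g Gg ->]].
    have sylP C : C \in P -> #|C| = 3 -> exists2 H : {group gT}, C = H &
      3.-Sylow(G) H.
      case/proper_CentsP=> x [Gx _ ->] oC3; exists 'C_G[x]%G => //.
      by rewrite pHallE subsetIl oG /= oC3 p_part;
        have -> : logn 3 12 = 1%N by [].
    have [H defA sylH] := sylP A PA o3; have [K defB sylK] := sylP B PB oB.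
    have [g Gg /= defK] := Sylow_trans sylH sylK.
    by exists g => //; rewrite defB defA defK.
  by rewrite proper_Cents_conj // cardJg o3.
case/proper_CentsP: (PA) => x [Gx _ defA].
have sAN : A \subset 'N_G(A) by rewrite defA subsetI subsetIl normG.
have dvd3 : 3 %| #|'N_G(A)| by move: sAN; rewrite -o3 defA; apply: cardSg.
have := Lagrange (subsetIl G 'N(A)); rewrite oG card_conjugates.
case/dvdnP: dvd3 => k ->; set i := #|_ : _| => eqi.
by apply/dvdnP; exists k; lia.
Qed.

Lemma card_ge7 : 7 <= #|G|.
Proof.
have := card_sum_proper_Cents;
  have : (\sum_(A in P) 1 <= \sum_(A in P) #|A|.-1)%N.
  by apply: leq_sum => A /card_proper_Cents_gt1; case: #|A| => [|[]].
by rewrite sum1_card card_proper_Cents7 => + eqn; rewrite eqn;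
  have := cardG_gt0 G; lia.
Qed.

Lemma card_le_proper_Cents k : (forall A, A \in P -> #|A| <= k.+1) ->
  #|G| <= (6 * k).+1.
Proof.
move=> leP; have : (\sum_(A in P) #|A|.-1 <= \sum_(A in P) k)%N.
  by apply: leq_sum => A /leP; case: #|A|.
rewrite sum_nat_const card_proper_Cents7 card_sum_proper_Cents.
by have := cardG_gt0 G; lia.
Qed.

Lemma not_pgroup_center1 (p : nat) : ~~ p.-group G.
Proof.
apply/negP=> pG; have := trivg_center_pgroup pG Z1.
by have := card_ge7 => /[swap] ->; rewrite cards1.
Qed.

Lemma prime_dvd_proper_Cents p : prime p -> p %| #|G| ->
  exists2 A, A \in P & p %| #|A|.
Proof.
move=> pr_p /(Cauchy pr_p)[x Gx ox]; exists 'C_G[x]; last first.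
  by rewrite -ox order_dvdG // subcent1_refl.
apply/proper_Cents_center1P; exists x; split=> //.
by rewrite -order_gt1 ox prime_gt1.
Qed.

Lemma exists_proper_Cents5 : exists2 A, A \in P & #|A| = 5.
Proof.
have [/exists_inP[A PA /eqP] | no5] := boolP [exists A in P, #|A| == 5].
  by exists A.
have {no5} le4 A : A \in P -> #|A| <= 4.
  move=> PA; have := card_proper_Cents_le5 PA;
    rewrite leq_eqVlt => /orP[/eqP o5|//].
  by case/negP: no5; apply/existsP; exists A; rewrite PA o5 eqxx.
have primes23 p : prime p -> p %| #|G| -> (p == 2) || (p == 3).
  move=> pr_p /(prime_dvd_proper_Cents pr_p)[A PA dvdp].
  have := dvdn_leq (ltnW (card_proper_Cents_gt1 PA)) dvdp.
  move/leq_trans/(_ (le4 A PA)); move: pr_p;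
    by case: p {dvdp} => [|[|[|[|[|]]]]].
have le19 := card_le_proper_Cents le4; have ge7 := card_ge7.
have not_pnat p := not_pgroup_center1 p.
(* The orders 7 to 19 are tried in turn: a prime factor above 3 contradicts [nop], and a power of 2
   or 3 contradicts [npn]. *)
have [o12 | o18] : #|G| = 12 \/ #|G| = 18.
  have nop p : prime p -> p %| #|G| -> 3 < p -> False.
    by move=> pr_p dvdp; case/orP: (primes23 p pr_p dvdp) => /eqP->.
  move: not_pnat nop; rewrite /pgroup; have : #|G| \in iota 7 13.
    by rewrite mem_iota ge7 ltnS.
  rewrite !inE => + npn nop.
  do !case/orP; move/eqP=> on; rewrite on in npn nop *; auto; exfalso.
  - exact: (nop 7).
  - by have := npn 2.
  - by have := npn 3.
  - exact: (nop 5).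
  - exact: (nop 11).
  - exact: (nop 13).
  - exact: (nop 7).
  - exact: (nop 5).
  - by have := npn 2.
  - exact: (nop 17).
  - exact: (nop 19).
- (* Parity count: among six orders in {2, 3, 4} with sum 17, an odd number
     equals 3; those are conjugate Sylow subgroups, so there is just one. *)
  have leT : (\sum_(A in P) (#|A|.-1 + (#|A| == 3)) =
              \sum_(A in P) (1 + (#|A| != 2).*2))%N.
    apply: eq_bigr => A PA; have := card_proper_Cents_gt1 PA; have := le4 A PA.
    by case: #|A| => [|[|[|[|[|]]]]].
  set S3 := [set B in P | #|B| == 3].
  have sumS3 : (\sum_(A in P) (#|A| == 3) = #|S3|)%N.
    by rewrite -sum1dep_card big_mkcondr; apply: eq_bigr => A _; case: eqP.
  have := leT; rewrite !big_split /= card_sum_proper_Cents o12 sumS3.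
  under [X in (_ = _ + X)%N -> _]eq_bigr do rewrite -mul2n.
  rewrite sum1_card card_proper_Cents7 -big_distrr /= => eqS3.
  have oddS3 : odd #|S3|.
    by have /(congr1 odd) := eqS3; rewrite oddD [in RHS]oddD oddM /=; case: odd.
  have [A] : exists A, A \in S3 by apply/set0Pn; rewrite -card_gt0 odd_gt0.
  rewrite inE => /andP[PA /eqP oA].
  have oS3 : #|S3| = 1%N.
    have dvdS := card_proper_Cents3_dvd4 PA oA o12; rewrite -/S3 in dvdS.
    have leS := dvdn_leq (isT : 0 < 4) dvdS; move: oddS3 dvdS leS.
    by case: #|S3| => [|[|[|[|[|]]]]].
  have invA : {in G, forall g, A :^ g = A}.
    move=> g Gg; have /eqP/cards1P[B defS3] := oS3.
    have: A \in S3 by rewrite inE PA oA.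
    have: A :^ g \in S3 by rewrite inE proper_Cents_conj // cardJg oA.
    by rewrite defS3 => /set1P-> /set1P->.
  have [x Ax nx1] : exists2 x, x \in A & x != 1.
    by case/proper_Cents_center1P: PA => x [Gx nx1 ->]; exists x => //;
      apply: subcent1_refl.
  have [sxA oG] := invariant_proper_Cents_class PA invA Ax nx1.
  have A1 : 1 \in A by case/proper_CentsP: PA => y [_ _ ->]; apply: group1.
  have oA1 : #|A^#| = 2 by have := cardsD1 1 A; rewrite A1 oA => -[].
  (* The class of [x] would have 12 / 3 = 4 elements inside the two-element set [A^#]. *)
  have := subset_leq_card sxA; rewrite oA1; move: oG; rewrite o12 oA.
  by case: #|_| => [|[|[|]]].
(* 4 does not divide 18, so all orders are at most 3 and G has at most 6 * 2 + 1 = 13 elements. *)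
- have le3 A : A \in P -> #|A| <= 3.
    move=> PA; have := card_proper_Cents_dvd PA; have := le4 A PA; rewrite o18.
    by case: #|A| => [|[|[|[|[|]]]]].
  by have := card_le_proper_Cents le3; rewrite o18.
Qed.



Lemma card_7_centralizer : exists A,
  [/\ A \in P, #|A| = 5, forall B, B \in P :\ A -> #|G| = (#|B| * 5)%N
    & #|G| = 10 \/ #|G| = 20].
Proof.
have [A PA oA] := exists_proper_Cents5; exists A.
have oG B : B \in P :\ A -> #|G| = (#|B| * 5)%N.
  by case/setD1P=> neBA PB; apply: card5_proper_Cents oA.
split=> //; have [B PAB] : exists B, B \in P :\ A.
  by apply/set0Pn; rewrite -card_gt0 card_proper_CentsD1.
have oGB := oG B PAB; have [neBA PB] := setD1P PAB.
have := card_proper_Cents_gt1 PB; have := card_proper_Cents_le5 PB.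
have no25 : #|B| <> 5.
  move=> oB; have := not_pgroup_center1 5.
  by rewrite /pgroup oGB oB.
(* In order 15, [A] is normal, since [oG] applied to another conjugate would give order 25. An
   element [y] of [B] raises [x] to a power j with j^3 = 1 mod 5, so j = 1 and [y] centralizes [x],
   although [A] and [B] meet trivially. *)
have no15 : #|B| <> 3.
  move=> oB; have invA : {in G, forall g, A :^ g = A}.
    move=> g Gg; apply/eqP; apply: contraTT isT => neAg.
    have := oG (A :^ g); rewrite in_setD1 neAg proper_Cents_conj // cardJg oA.
    by rewrite oGB oB => /(_ isT).
  have [x Gx [nx1 defA]] : exists2 x, x \in G & x != 1 /\ A = 'C_G[x].
    by case/proper_Cents_center1P: PA => x [Gx nx1 ->]; exists x.
  have [y By ny1] : exists2 y, y \in B & y != 1.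
    case/proper_Cents_center1P: PB => y [Gy ny1 ->].
    by exists y => //; apply: subcent1_refl.
  have Ax : x \in A by rewrite defA subcent1_refl.
  have ox : #[x] = 5.
    apply/prime_nt_dvdP => //; first by rewrite order_eq1.
    by rewrite -oA defA order_dvdG ?subcent1_refl.
  have defAx : A = <[x]>.
    by apply/eqP; rewrite eq_sym eqEcard oA -orderE ox leqnn andbT defA
      cycle_subG subcent1_refl.
  have Gy := subsetP (proper_Cents_sub PB) y By.
  have y3 : y ^+ 3 = 1.
    apply/eqP; rewrite -order_dvdn -oB.
    by case/proper_CentsP: PB By => z [_ _ ->]; apply: order_dvdG.
  have /cycleP[i xy] : x ^ y \in <[x]> by rewrite -defAx -(invA y Gy)
    memJ_conjg.
  have := conjg_iter_exp 3 xy; rewrite y3 conjg1 => /eqP.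
  rewrite -{1}[x]expg1 eq_expg_mod_order ox.
  have xyi : x ^ y = x ^+ (i %% 5) by rewrite xy -ox expg_mod_order.
  rewrite -modnXm; move: (i %% 5) (ltn_pmod i (isT : 0 < 5)) xyi =>
    j lt5 xyj eqj.
  have {lt5 eqj} j1 : j = 1%N by case: j eqj lt5 xyj => [|[|[|[|[|]]]]].
  have : y \in 'C_G[x].
    by apply/subcent1P; split=> //; apply/commgP/conjg_fixP;
      rewrite xyj j1 expg1.
  rewrite -defA => Ay; have := proper_Cents_TI PB PA neBA => /setP/(_ y).
  by rewrite in_setI By Ay inE (negPf ny1).
rewrite oGB; case: #|B| no25 no15 => [|[|[|[|[|[|]]]]]] //; by auto.
Qed.

End TrivialCenter.

End SevenCentralizers.

(** * Groups generated like D_10 and R: CA-groups with trivial center and seven centralizers *)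

Section Metacyclic.

Variables (gT : finGroupType) (G : {group gT}) (x y : gT) (m e : nat).
Hypotheses (defG : <[x]> <*> <[y]> = G) (x5 : x ^+ 5 = 1) (ym : y ^+ m = 1).
Hypotheses (xy : x ^ y = x ^+ e) (oG : #|G| = (5 * m)%N).
(** The first case is D_10, where [y] inverts [x]; the second is R. *)
Hypothesis (me : m = 2 /\ e = 4 \/ m = 4 /\ e = 3).

Let m_gt0 : 0 < m. Proof. by case: me => -[-> _]. Qed.

Let Gx : x \in G. Proof. by rewrite -defG mem_gen // inE cycle_id. Qed.

Let Gy : y \in G. Proof. by rewrite -defG mem_gen // inE cycle_id orbT. Qed.

Let nxy : y \in 'N(<[x]>). Proof.
  by rewrite -cycle_subG norms_cycle xy mem_cycle. Qed.

(** G is the product of the two cyclic groups and [y] has order at most [m], so [x] cannot be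
    trivial. *)
Let ox : #[x] = 5.
Proof.
have leG : 5 * m <= #[x] * #[y].
  rewrite -oG -defG norm_joinEr ?cycle_subG // !orderE mul_cardG.
  by rewrite leq_pmulr ?cardG_gt0.
have ley : #[y] <= m by rewrite dvdn_leq // order_dvdn ym.
apply/prime_nt_dvdP; rewrite ?order_dvdn ?x5 //.
by apply: contraTneq leG => ->; rewrite -ltnNge mul1n; lia.
Qed.

Let nAG : <[x]> <| G.
Proof.
by rewrite /normal cycle_subG Gx -defG join_subG normG cycle_subG.
Qed.

Let cent_x : 'C_G[x] = <[x]>.
Proof.
have sAC : <[x]> \subset 'C_G[x] by rewrite cycle_subG subcent1_refl.
have [k oC] : exists k, #|'C_G[x]| = (k * 5)%N.
  by apply/dvdnP; rewrite -ox; apply: cardSg.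
have neX i j : i < 5 -> j < 5 -> i != j -> x ^+ i != x ^+ j.
  by move=> lti ltj; rewrite eq_expg_mod_order ox !modn_small.
(* The class size divides [m], so for [m = 4] three conjugates, with exponents 1, 3 and 9 = 4 mod 5,
   already force it to be 4. *)
have oclass : m <= #|x ^: G| + (m == 4).
  have xX i : x ^ (y ^+ i) = x ^+ (e ^ i %% 5).
    by rewrite (conjg_iter_exp i xy) -ox expg_mod_order.
  have clX i : x ^+ (e ^ i %% 5) \in x ^: G by rewrite -xX memJ_class // groupX.
  case: me => -[-> def_e]; rewrite ?addn0 ?addn1 ?ltnS; apply/card_geqP.
    exists [:: x ^+ 1; x ^+ 4]; split=> //=; first by rewrite inE neX.
    by apply/allP; rewrite /= (clX 0) andbT; have := clX 1%N; rewrite def_e.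
  exists [:: x ^+ 1; x ^+ 3; x ^+ 4]; split=> //=;
    first by rewrite !inE !negb_or !neX.
  apply/allP; rewrite /= (clX 0) /= andbT.
  by have := clX 1%N; have := clX 2; rewrite def_e => -> ->.
have := Lagrange (subsetIl G 'C[x]); rewrite /= index_cent1 oC oG => eqk.
apply/esym/eqP; rewrite eqEcard sAC -orderE ox oC.
by case: me oclass eqk => -[-> _] /=; move: #|_| => c; clear; nia.
Qed.

Let cent_A a : a \in <[x]> -> a != 1 -> 'C_G[a] = <[x]>.
Proof.
move=> Aa na1; suff eqA : <[a]> = <[x]> by rewrite -cent_cycle eqA cent_cycle.
apply/eqP; rewrite eqEcard cycle_subG Aa -!orderE ox.
rewrite (_ : #[a] = 5) //; apply/prime_nt_dvdP; rewrite ?order_eq1 //.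
by rewrite -ox order_dvdG.
Qed.

Lemma metacyclic_center : 'Z(G) = 1.
Proof.
apply/trivgP/subsetP=> z Zz; apply: contraLR isT => nz1.
have Gz := subsetP (center_sub G) z Zz.
have Az : z \in <[x]>.
  rewrite -cent_x; apply/subcent1P; split=> //.
  by case/setIP: Zz => _ /centP/(_ x Gx)/commute_sym.
rewrite inE in nz1; move: Zz;
  rewrite -subcent1_eqG // (cent_A Az nz1) => /eqP eqG.
have := oG; rewrite -eqG -orderE ox; have := me; lia.
Qed.

Let m_abelian (gT' : finGroupType) (H : {group gT'}) : #|H| = m -> abelian H.
Proof.
move=> oH; apply: (@p2group_abelian _ 2).
  by rewrite /pgroup oH; case: me => -[-> _].
by rewrite oH; case: me => -[-> _].
Qed.

(** The centralizer meets [<[x]>] trivially, so its order is at most [m]. The quotient by [<[x]>] is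
    abelian, so the class of [u] lies in a coset of five elements, which gives the reverse bound. *)
Let card_cent u : u \in G -> u \notin <[x]> -> #|'C_G[u]| = m.
Proof.
move=> Gu nAu.
have TI : <[x]> :&: 'C_G[u] = 1.
  apply/trivgP/subsetP=> a /setIP[Aa Cua]; apply: contraR nAu;
    rewrite inE => na1.
  by rewrite -(cent_A Aa na1); apply: subcent1_sym Cua Gu.
have leC : #|'C_G[u]| <= m.
  rewrite -(leq_pmul2l (isT : 0 < 5)) -oG -ox -TI_cardMg //.
  by rewrite subset_leq_card // mul_subG ?subsetIl ?normal_sub.
have sCl : u ^: G \subset u *: <[x]>.
  apply/subsetP=> _ /imsetP[g Gg ->]; rewrite mem_lcoset.
  have/subsetP -> // : G^`(1) \subset <[x]>.
    rewrite der1_min ?normal_norm // m_abelian // card_quotient ?normal_norm //.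
    by rewrite -divgS ?normal_sub // -orderE ox oG mulKn.
  exact: mem_commg.
have := subset_leq_card sCl; rewrite card_lcoset -orderE ox.
have := Lagrange (subsetIl G 'C[u]); rewrite /= index_cent1 oG => eq5 le5.
by move: leC eq5 le5; move: #|_| #|u ^: G| => c k; clear -m_gt0; nia.
Qed.

Lemma metacyclic_CA : CA_group G.
Proof.
apply/forall_inP=> u /setDP[Gu ncu]; have [Au | nAu] := boolP (u \in <[x]>).
  rewrite cent_A ?cycle_abelian //; apply: contraNneq ncu => ->.
  exact: group1.
by apply: m_abelian; apply: card_cent.
Qed.

(** With c proper centralizers besides [<[x]>], counting nontrivial elements gives 5m - 1 = 4 + c(m
    - 1), so c = 5; [<[x]>] and G make seven. *)
Lemma metacyclic_card_Cents : #|Cents G| = 7.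
Proof.
have PA : <[x]> \in Cents G :\ gval G.
  apply/proper_CentsP; exists x; split; rewrite ?cent_x //.
  by rewrite metacyclic_center inE -order_eq1 ox.
have := card_sum_proper_Cents metacyclic_CA metacyclic_center.
rewrite (bigD1 <[x]>) //= -orderE ox oG.
rewrite (eq_bigr (fun => m.-1)) =>
  [|_ /andP[/proper_CentsP[u [Gu ncu ->]] neA]].
  rewrite (eq_bigl [in Cents G :\ gval G :\ <[x]>]) => [|B]; last first.
    by rewrite [RHS]in_setD1 andbC.
  have -> : #|Cents G| = #|Cents G :\ gval G :\ <[x]>|.+2.
    by rewrite (cardsD1 (gval G)) CentsG (cardsD1 <[x]> (_ :\ _)) PA.
  rewrite sum_nat_const; move: #|_ :\ <[x]>| => c.
  by case: me => -[-> _] /=; lia.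
rewrite card_cent //; apply: contra neA => Au; rewrite cent_A //.
by apply: contraNneq ncu => ->; apply: group1.
Qed.

End Metacyclic.

(** * From the presentations of R and D_10 to generators and orders *)

Section Presentations.

(** [isog_R] only compares homomorphic images; a concrete semidirect product is what shows that the
    presented group has order 20. *)
Definition R_model : finGroupType := Extremal.gtype 5 4 3.

Lemma R_model_isog : isog_R [set: R_model].
Proof.
have isoE : [set: R_model] \isog Grp (x : y : x ^+ 5, y ^+ 4, x ^ y = x ^+ 3).
  apply: Extremal.Grp => //; set b : 'Z_5 := Zp1.
  have ob : #[b] = 5 by rewrite order_Zp1.
  have u3 : (3%:R : 'Z_(#[b]))%R \is a GRing.unit by rewrite unitZpE ob.
  have AutS : Zp_unitm (FinRing.unit 'Z_(#[b]) u3) \in Aut <[b]>.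
    by rewrite -im_Zp_unitm mem_morphim ?inE.
  exists (Zp_unitm (FinRing.unit 'Z_(#[b]) u3)); split=> //.
  - have oAut : #|Aut <[b]>| = 4 by rewrite card_Aut_cyclic ?cycle_cyclic //
      -orderE ob.
    by rewrite -[X in _ %| X]oAut order_dvdG.
  by rewrite autE ?cycle_id //= /cyclem ob.
move=> gT H; rewrite isoE; apply/existsP/existsP=> -[[x y] /=];
  rewrite !xpair_eqE => /and4P[defH x5 y4 xy]; exists (x, y);
  rewrite !xpair_eqE defH x5 y4 /=.
  by rewrite conjgC (eqP xy).
by rewrite conjgE (eqP xy) mulKg.
Qed.

Lemma card_R_model : #|[set: R_model]| = 20.
Proof. exact: Extremal.card. Qed.

(** Universality gives surjections both ways between G and [R_model], hence the order. Conversely, a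
    quotient of [R_model] of order 20 is isomorphic to it. *)
Lemma isog_RP (gT : finGroupType) (G : {group gT}) :
  isog_R G <-> #|G| = 20 /\ exists x y,
    [/\ <[x]> <*> <[y]> = G, x ^+ 5 = 1, y ^+ 4 = 1 & x ^ y = x ^+ 3].
Proof.
have homP (rT : finGroupType) (H : {group rT}) :
  (H \homg Grp (x : y : x ^+ 5, y ^+ 4, x * y = y * x ^+ 3)) <->
  exists x y, [/\ <[x]> <*> <[y]> = H, x ^+ 5 = 1, y ^+ 4 = 1 & x ^ y = x ^+ 3].
  split=> [/existsP[[x y] /=] | [x [y [defH x5 y4 xy]]]].
    rewrite !xpair_eqE => /and4P[/eqP defH /eqP x5 /eqP y4 /eqP xy].
    by exists x, y; split=> //; rewrite conjgE xy mulKg.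
  apply/existsP; exists (x, y); rewrite /= !xpair_eqE defH x5 y4 !eqxx /=.
  by rewrite conjgC xy.
split=> [isoG | [oG /homP homG]].
  have homG := isoGrp_hom isoG; split; last exact/homP.
  have homGR : G \homg [set: R_model] by rewrite R_model_isog.
  have homRG : [set: R_model] \homg G by rewrite isoG (isoGrp_hom R_model_isog).
  by have := isogEhom G [set: R_model];
    rewrite homGR homRG -card_R_model => /card_isog.
apply: isoGrp_trans R_model_isog; apply/(isoGrpP _ R_model_isog).
by rewrite card_R_model.
Qed.

(** Inversion is written as the fourth power to match the case [e = 4] of [me]. *)
Lemma isog_D10_gens (gT : finGroupType) (G : {group gT}) :
  G \isog 'D_10 -> #|G| = 10 /\ exists x y,
    [/\ <[x]> <*> <[y]> = G, x ^+ 5 = 1, y ^+ 2 = 1 & x ^ y = x ^+ 4].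
Proof.
move/(isoGrpP _ (@Grp_dihedral 5 isT));
  rewrite (@card_dihedral 5) // => -[-> /existsP[[x y]] /=].
rewrite !xpair_eqE => /and4P[/eqP defH /eqP x5 /eqP y4 /eqP xy].
split=> //; exists x, y; split=> //; rewrite xy.
by apply/eqP; rewrite eq_invg_mul -expgS x5.
Qed.

Lemma D10_or_R_centralizers (gT : finGroupType) (G : {group gT}) :
  G \isog 'D_10 \/ isog_R G -> [/\ CA_group G, 'Z(G) = 1 & #|Cents G| = 7].
Proof.
case=> [/isog_D10_gens[oG [x [y [defG x5 ym xy]]]] |
        /isog_RP[oG [x [y [defG x5 ym xy]]]]].
  have me : 2 = 2 /\ 4 = 4 \/ 2 = 4 /\ 4 = 3 by left.
  split; first exact: metacyclic_CA defG x5 ym xy oG me.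
    exact: metacyclic_center defG x5 ym xy oG me.
  exact: metacyclic_card_Cents defG x5 ym xy oG me.
have me : 4 = 2 /\ 3 = 4 \/ 4 = 4 /\ 3 = 3 by right.
split; first exact: metacyclic_CA defG x5 ym xy oG me.
  exact: metacyclic_center defG x5 ym xy oG me.
exact: metacyclic_card_Cents defG x5 ym xy oG me.
Qed.

End Presentations.

(** * Identification of the groups of order 10 and 20 *)

Section Classification.

Variables (gT : finGroupType) (G : {group gT}).
Hypotheses (caG : CA_group G) (Z1 : 'Z(G) = 1) (oC : #|Cents G| = 7).
Let P := Cents G :\ gval G.

(** Two members of order 2 supply distinct involutions, which generate a dihedral subgroup of order
    2k with k dividing 5. If k = 1, both would lie in the same member. *)
Lemma card10_isog_D10 : #|G| = 10 -> G \isog 'D_10.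
Proof.
move=> oG; have [A [PA _ oB _]] := card_7_centralizer caG Z1 oC.
have : 1 < #|P :\ A| by rewrite card_proper_CentsD1.
case/card_gt1P=> B1 [B2 [PB1 PB2 neB]].
have invol B : B \in P :\ A -> exists2 y, y \in B & #[y] = 2.
  move=> PB; have := oB B PB; rewrite oG => oB2.
  case/setD1P: PB => _ /(proper_Cents_center1P Z1)[y [Gy ny1 defB]].
  exists y; first by rewrite defB subcent1_refl.
  apply/prime_nt_dvdP; rewrite ?order_eq1 //.
  have -> : 2 = #|B| by lia.
  by rewrite defB order_dvdG // subcent1_refl.
have [[y B1y oy] [z B2z oz]] := (invol B1 PB1, invol B2 PB2).
have [[_ {}PB1] [_ {}PB2]] := (setD1P PB1, setD1P PB2).
have nB1z : z \notin B1.
  have /setP/(_ z) := proper_Cents_TI caG Z1 PB1 PB2 neB.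
  by rewrite in_setI B2z inE -order_eq1 oz andbT => ->.
have neyz : y != z by apply: contraNneq nB1z => <-.
pose H := <<[set y; z]>>%G.
have isoH : H \isog 'D_#|H| := involutions_gen_dihedral oy oz neyz.
have sHG : H \subset G.
  rewrite gen_subG subUset !sub1set (subsetP (proper_Cents_sub PB1)) //.
  exact: (subsetP (proper_Cents_sub PB2)).
have Hy : y \in H by rewrite mem_gen ?set21.
have [k oH] : exists k, #|H| = (k * 2)%N.
  by apply/dvdnP; rewrite -oy order_dvdG.
have : k %| 5 by have := cardSg sHG; rewrite oG oH -[10]/(5 * 2)%N dvdn_pmul2r.
rewrite (dvdn_divisors _ (isT : 0 < 5)) !inE => /orP[] /eqP k_eq; last first.
  have defG : H = G by apply/eqP; rewrite -val_eqE /= eqEcard sHG oG oH k_eq.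
  by move: isoH; rewrite defG oG.
case/negP: nB1z; case/proper_CentsP: PB1 B1y => u [_ _ ->].
rewrite -cycle_subG => /subsetP; apply.
suff -> : <[y]> = H by rewrite mem_gen ?set22.
by apply/eqP; rewrite eqEcard cycle_subG Hy -orderE oy oH k_eq.
Qed.

Lemma card20_isog_R : #|G| = 20 -> isog_R G.
Proof.
move=> oG; have [A [PA oA oB _]] := card_7_centralizer caG Z1 oC.
have [x Gx [nx1 defA]] : exists2 x, x \in G & x != 1 /\ A = 'C_G[x].
  by case/(proper_Cents_center1P Z1): PA => x [Gx nx1 ->]; exists x.
have Ax : x \in A by rewrite defA subcent1_refl.
have invA : {in G, forall g, A :^ g = A}.
  move=> g Gg; apply/eqP; apply: contraTT isT => neAg.
  have := oB (A :^ g); rewrite in_setD1 neAg proper_Cents_conj // cardJg oA oG.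
  by move/(_ isT).
have [sxA oGx] := invariant_proper_Cents_class caG Z1 PA invA Ax nx1.
have ox : #[x] = 5.
  apply/prime_nt_dvdP => //; first by rewrite order_eq1.
  by rewrite -oA defA order_dvdG ?subcent1_refl.
have oA1 : #|A^#| = 4.
  have := cardsD1 1 A; rewrite oA {1}defA group1.
  by case.
(* The class of [x] has 20 / 5 = 4 elements, so it fills [A^#]; an element conjugating [x] to its
   cube serves as the second generator. *)
have : x ^+ 3 \in x ^: G.
  have /eqP -> : x ^: G == A^#.
    by rewrite eqEcard sxA oA1; move: oGx; rewrite oG oA; lia.
  rewrite in_setD1 -order_dvdn ox /=; move: Ax; rewrite defA.
  exact: groupX.
case/imsetP=> y Gy xy.
(* Conjugation by [y ^+ 2] raises [x] to the ninth power, and 9 is not 1 mod 5. With a centralizer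
   of order 4, [y] then has order exactly 4. *)
have y2 : y ^+ 2 != 1.
  apply/eqP=> y2; have := conjg_iter_exp 2 (esym xy).
  by rewrite y2 conjg1 => /eqP; rewrite -{1}[x]expg1 eq_expg_mod_order ox.
have nAy : y \notin A.
  rewrite defA; apply/negP=> /subcent1P[_ cxy]; move/eqP: xy.
  have /conjg_fixP -> : [~ x, y] == 1 by apply/commgP.
  by rewrite -{2}[x]expg1 eq_expg_mod_order ox.
have ny1 : y != 1 by apply: contraNneq y2 => ->; rewrite expg1n.
have oy : #[y] = 4.
  have dvd4 : #[y] %| 4.
    have := oB 'C_G[y]; rewrite in_setD1.
    have -> : 'C_G[y] \in P.
      by apply/(proper_Cents_center1P Z1); exists y.
    have -> : 'C_G[y] != A by apply: contraNneq nAy => <-; apply: subcent1_refl.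
    move=> /(_ isT); rewrite oG => oCy.
    have oCy4 : #|'C_G[y]| = 4 by move: oCy; move: #|_| => c; lia.
    by rewrite -[X in _ %| X]oCy4 order_dvdG ?subcent1_refl.
  move: y2 dvd4; rewrite -order_dvdn (dvdn_divisors _ (isT : 0 < 4)) !inE.
  by move=> + /or3P[] /eqP oy; rewrite oy.
have defG : <[x]> <*> <[y]> = G.
  have sHG : <[x]> <*> <[y]> \subset G by rewrite join_subG !cycle_subG Gx.
  apply/eqP; rewrite eqEcard sHG oG dvdn_leq ?cardG_gt0 //.
  rewrite (@Gauss_dvd 5 4) // -{1}ox -oy !orderE !cardSg ?joing_subl
    ?joing_subr //.
apply/isog_RP; split=> //; exists x, y.
by split; rewrite // -?ox -?oy expg_order.
Qed.

Lemma card7_Cents_D10_or_R : G \isog 'D_10 \/ isog_R G.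
Proof.
have [A [_ _ _ [oG | oG]]] := card_7_centralizer caG Z1 oC.
  by left; apply: card10_isog_D10.
by right; apply: card20_isog_R.
Qed.

End Classification.

(** * Centralizers in G and in G/Z(G) *)

Section CentralQuotient.

Variables (gT : finGroupType) (G : {group gT}).
Hypothesis caG : CA_group G.
Let Q := (G / 'Z(G))%G.

Let nZG : G \subset 'N('Z(G)). Proof. exact: normal_norm (center_normal G). Qed.

(** Lift [q] to [g] and take [h] outside C(g). By [CA_coset_class] the elements [h * g ^+ i] have
    distinct centralizers for i below the order of [q]; the added 2 accounts for G and C(g). *)
Lemma quotient_order_bound q : q \in Q -> q != 1 -> #[q] + 2 <= #|Cents G|.
Proof.
case/morphimP=> g Ng Gg -> nq1.
have ncg : g \notin 'Z(G).
  by apply: contra nq1 => Zg; rewrite /= coset_id.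
have [h Gh nCh] : exists2 h, h \in G & h \notin 'C_G[g].
  apply/subsetPn; apply: contra ncg => sGC.
  by rewrite -subcent1_eqG // eqEsubset subsetIl.
have Cg := subcent1_refl Gg.
pose f (i : 'I_#[coset 'Z(G) g]) := 'C_G[h * g ^+ i].
have inj_f : injective f.
  move=> i j eqf; apply: val_inj; apply/eqP.
  have := CA_coset_class caG Gg ncg Gh nCh (groupX i Cg) (groupX j Cg) eqf.
  move=> Zij.
  have: coset 'Z(G) ((g ^+ i)^-1 * g ^+ j) = 1 by apply: coset_id.
  rewrite morphM ?groupV ?groupX // morphV ?groupX // !morphX //= => /eqP.
  by rewrite -eq_mulVg1 eq_expg_mod_order !modn_small.
have sub_f : [set f i | i in 'I_#[coset 'Z(G) g]] \subset Cents G :\ gval G :\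
  'C_G[g].
  by apply/subsetP=> _ /imsetP[i _ ->]; apply: coset_class_mem (groupX i Cg).
have := subset_leq_card sub_f; rewrite card_imset // card_ord.
rewrite (cardsD1 (gval G) (Cents G)) CentsG.
rewrite (cardsD1 'C_G[g] (Cents G :\ gval G)).
have -> : 'C_G[g] \in Cents G :\ gval G by apply/proper_CentsP; exists g.
by rewrite addnC addnA leq_add2l.
Qed.

(* If [g0] maps to a nontrivial central element of [Q] and [g2] to a noncentral
   one, then [g2] and [g2 * g0] have different centralizers in [G] while their
   images have the same centralizer in [Q]. *)
Lemma card_Cents_quotient_lt :
  CA_group Q -> ~~ abelian Q -> 'Z(Q) != 1 -> #|Cents Q| < #|Cents G|.
Proof.
move=> caQ nabQ /trivgPn[z Zz nz1].
have Qz := subsetP (center_sub Q) z Zz.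
have /morphimP[g0 N0 G0 def_z] := Qz.
have nc0 : g0 \notin 'Z(G).
  by apply: contra nz1 => Zg; rewrite def_z /= coset_id.
have Nin g : g \in G -> g \in 'N('Z(G)) by apply: (subsetP nZG).
have Qc g : g \in G -> coset 'Z(G) g \in Q by apply: mem_quotient.
have [g2 G2 /andP[nC2 nc2]] : exists2 g2, g2 \in G &
    (g2 \notin 'C_G[g0]) && (coset 'Z(G) g2 \notin 'Z(Q)).
  have [q Qq ncq] : exists2 q, q \in Q & q \notin 'Z(Q).
    apply/subsetPn; apply: contra nabQ => sGZ.
    by apply/center_idP/eqP; rewrite eqEsubset center_sub.
  have /morphimP[g Ng Gg def_q] := Qq; rewrite def_q in ncq.
  have [C0g | nC0g] := boolP (g \in 'C_G[g0]); last by exists g; rewrite ?nC0g.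
  have [h Gh nCh] : exists2 h, h \in G & h \notin 'C_G[g0].
    apply/subsetPn; apply: contra nc0 => sGC.
    by rewrite -subcent1_eqG // eqEsubset subsetIl.
  have [Zh | nch] := boolP (coset 'Z(G) h \in 'Z(Q)); last by exists h;
    rewrite ?nCh.
  exists (h * g); first exact: groupM.
  rewrite (groupMr _ C0g) nCh morphM ?Nin //=.
  by rewrite (groupMl _ Zh).
(* Using ['Z(A)] handles all cases at once: it is [A] for a proper centralizer, while [A = G] gives
   a trivial quotient and hence the value [Q]. *)
pose psi (A : {set gT}) := 'C_Q('Z(A) / 'Z(G)).
have psiE g : g \in G -> coset 'Z(G) g \notin 'Z(Q) ->
  psi 'C_G[g] = 'C_Q[coset 'Z(G) g].
- move=> Gg ncq; have ncg : g \notin 'Z(G).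
    by apply: contra ncq => Zg; rewrite coset_id // group1.
  have abC := CA_cent1_abelian caG Gg ncg.
  rewrite /psi (center_idP abC); apply/eqP; rewrite eqEsubset; apply/andP;
    split.
    rewrite setIS // -(cent_set1 (coset _ g)) centS // sub1set mem_quotient //.
    exact: subcent1_refl.
  have sCQ : 'C_G[g] / 'Z(G) \subset 'C_Q[coset 'Z(G) g].
    apply/subsetP=> _ /morphimP[u Nu /subcent1P[Gu cgu] ->].
    apply/subcent1P; split; first exact: Qc.
    by rewrite /commute -!morphM ?Nin //= cgu.
  rewrite subsetI subsetIl /=.
  exact: subset_trans (CA_cent1_abelian caQ (Qc g Gg) ncq) (centS sCQ).
have G20 : g2 * g0 \in G by rewrite groupM.
have nc20 : coset 'Z(G) (g2 * g0) \notin 'Z(Q).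
  by rewrite morphM ?Nin //= -def_z (groupMr _ Zz).
have eq20 : 'C_Q[coset 'Z(G) (g2 * g0)] = 'C_Q[coset 'Z(G) g2].
  apply: CA_cent1_eq (Qc g2 G2) _ nc20 _ => //.
  apply/subcent1P; split; first exact: Qc.
  rewrite morphM ?Nin //= -def_z; apply: commuteM => //.
  by case/setIP: Zz => _ /centP/(_ _ (Qc g2 G2))/commute_sym.
pose D := Cents G :\ 'C_G[g2 * g0].
have neG g : g \in G -> coset 'Z(G) g \notin 'Z(Q) -> gval G != 'C_G[g].
  move=> Gg; apply: contra; rewrite eq_sym subcent1_eqG // => Zg.
  by rewrite coset_id // group1.
have ne2 : 'C_G[g2] != 'C_G[g2 * g0].
  apply: contra nC2 => /eqP eqC; have := subcent1_refl G2; rewrite eqC.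
  move/subcent1_sym/(_ G20); rewrite (groupMl _ (subcent1_refl G2)).
  by move/subcent1_sym; apply.
(* [psi] maps Cent(G) onto a set containing Cent(Q) even after one of two members with equal image
   is removed. *)
suff sQD : Cents Q \subset [set psi A | A in D].
  have := leq_trans (subset_leq_card sQD) (leq_imset_card psi D).
  by rewrite [X in _ < X](cardsD1 'C_G[g2 * g0]) mem_Cents.
apply/subsetP=> _ /imsetP[_ /morphimP[g Ng Gg ->] ->].
have [Zq | ncq] := boolP (coset 'Z(G) g \in 'Z(Q)).
  apply/imsetP; exists (gval G); first by rewrite in_setD1 CentsG neG.
  rewrite /psi -/(gval Q) trivg_quotient.
  by move: Zq; rewrite -subcent1_eqG ?Qc // => /eqP->; rewrite cent1T setIT.
rewrite /= -psiE //; have [eqg | neg] := eqVneq 'C_G[g] 'C_G[g2 * g0].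
  rewrite eqg psiE // eq20 -psiE //.
  by apply: imset_f; rewrite in_setD1 ne2 mem_Cents.
by apply: imset_f; rewrite in_setD1 neg mem_Cents.
Qed.

End CentralQuotient.

Lemma two_7_centralizerP (gT : finGroupType) (G : {group gT}) :
  two_n_centralizer 7 G <->
  [\/ G \isog 'D_10, isog_R G | 'Z(G) != 1 /\ n_centralizer 6 G].
Proof.
have nonabelian n : n > 1 -> #|Cents G| = n -> ~~ abelian G.
  by move=> n_gt1 oC; apply/negP=> /abelian_card_Cents; rewrite oC => n1;
    rewrite n1 in n_gt1.
split=> [/two_7_centralizer_CA[caG _] | ].
  have [Z1 oC | ntZ oC] := eqVneq 'Z(G) 1; last by constructor 3.
  by case: (card7_Cents_D10_or_R caG Z1 oC); [constructor 1 | constructor 2].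
have frob : G \isog 'D_10 \/ isog_R G -> two_n_centralizer 7 G.
  case/D10_or_R_centralizers=> caG Z1 oC.
  by rewrite /two_n_centralizer CA_card_two_Cents ?(nonabelian 7) // oC Z1 eqxx.
case=> [isoD | isoR | [ntZ oC]]; [by apply: frob; left | by apply: frob;
  right |].
have caG : CA_group G by apply: card_Cents_le7_CA; rewrite oC.
by rewrite /two_n_centralizer CA_card_two_Cents ?(nonabelian 6) // oC ntZ.
Qed.

Theorem theorem4p7 (gT : finGroupType) (G : {group gT}) :
  (two_n_centralizer 7 G <->
     [\/ G \isog 'D_10, isog_R G | 'Z(G) != 1 /\ n_centralizer 6 G])
  /\
  (primitive_two_n_centralizer 7 G <-> G \isog 'D_10 \/ isog_R G).
Proof.
split; first exact: two_7_centralizerP.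
split=> [[eqGQ o2Q] | isoG].
  have /two_7_centralizerP[isoD | isoR | [ntZ oC]] : two_n_centralizer 7 G.
  - by rewrite /two_n_centralizer eqGQ.
  - by left.
  - by right.
  have caG : CA_group G by apply: card_Cents_le7_CA; rewrite oC.
  (* An element of order 5 in the quotient would require 5 + 2 <= 6. *)
  have no5 : ~~ (5 %| #|G / 'Z(G)|).
    apply/negP=> /(Cauchy (isT : prime 5))[q Qq oq].
    have := quotient_order_bound caG Qq.
    by rewrite -order_eq1 oq oC => /(_ isT).
  have [caQ nabQ _] := two_7_centralizer_CA o2Q.
  (* The classification is applied again, now to G/Z(G): the first two cases have order divisible by
     5, and the third contradicts the strict drop in the number of centralizers. *)
  have /two_7_centralizerP[isoD | isoR | [ntZQ oCQ]] := o2Q.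
  - by case/negP: no5; rewrite (isog_D10_gens isoD).1.
  - by case/negP: no5; case/isog_RP: isoR => ->.
  by have := card_Cents_quotient_lt caG caQ nabQ ntZQ; rewrite oCQ oC.
have o2 : two_n_centralizer 7 G.
  by apply/two_7_centralizerP; case: isoG; [constructor 1 | constructor 2].
have [_ Z1 _] := D10_or_R_centralizers isoG.
have isoQ : G / 'Z(G) \isog G by rewrite Z1 isog_sym quotient1_isog.
suff o2Q : two_n_centralizer 7 (G / 'Z(G))%G by rewrite
  /primitive_two_n_centralizer o2Q.
apply/two_7_centralizerP; case: isoG => [isoD | isoR].
  by constructor 1; apply: isog_trans isoD.
by constructor 2; apply: isoGrp_trans isoR.
Qed.
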